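(* For every bijection $\varphi:\mathbb{N}\to\mathbb{Q}$ there does not exist a real number $\xi$ such that $F_\varphi$ is differentiable at $\xi$ and $F_\varphi'(\xi)\neq 0$.
   Context: $\mathbb{N}=\{1,2,3,\dots\}$. For a bijection $\varphi:\mathbb{N}\to\mathbb{Q}$, the function $F_\varphi:\mathbb{R}\to\mathbb{R}$ is defined by $$F_\varphi(x)=\sum_{\varphi(n)<x}\frac{1}{2^n},$$ where the summation is extended over all $n\in\mathbb{N}$ with $\varphi(n)<x$. Differentiable means differentiable with a finite derivative. *)

(* Defs.v *)
From HB Require Import structures.
From mathcomp Require Import all_boot all_order all_algebra.
From mathcomp Require Import boolp classical_sets functions reals topology normedtype sequences derive.
Set Implicit Arguments.
Unset Strict Implicit.
Unset Printing Implicit Defensive.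
Import Order.TTheory GRing.Theory Num.Theory.
Import numFieldNormedType.Exports.
Local Open Scope classical_set_scope.
Local Open Scope ring_scope.

(* The indices are 1, 2, 3, ...: the value [phi 0] is never used.  The terms
   are nonnegative and dominated by a convergent geometric series, so the limit
   of the partial sums always exists and does not depend on the order of
   summation. *)
Definition F (R : realType) (phi : nat -> rat) (x : R) : R :=
  limn (fun N => \sum_(1 <= n < N | ratr (phi n) < x) (1 / 2 ^+ n) : R).

(* Main.v *)
Require Import Defs.
From HB Require Import structures.
From mathcomp Require Import all_boot all_order all_algebra.
From mathcomp Require Import boolp classical_sets functions reals topology normedtype sequences derive.
From mathcomp Require Import ring lra.
Import Order.TTheory GRing.Theory Num.Theory.
Import numFieldNormedType.Exports.
Local Open Scope classical_set_scope.
Local Open Scope ring_scope.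

(** A nonzero slope at [xi] would force an atom near [xi] that is too large.
    [F phi] is the distribution function of the measure with mass [1 / 2 ^ n]
    at [phi n].  Let [h > 0] be small and let [n] be the least index with
    [phi n] in [[xi, xi + h)].  All the mass of this interval is carried by
    indices at least [n], so by the geometric series it is at most twice the
    mass of the single atom [phi n] ([F_increment_le]).  Hence, if the slope
    [c] at [xi] is not zero (and then positive, by monotonicity), the jump at
    [phi n] is at least about [c * h / 2] ([F_jump]).  But a function with a
    finite derivative at [xi] has only jumps of size [o(h)] within distance
    [h] of [xi].  With the relative error [c / 6] in the definition of the
    derivative the two estimates become [5 * c * h / 6 <= 4 * c * h / 6]. *)

(** * Increments of the jump function *)

Lemma sum_half_pow_le (R : realType) (n N : nat) :
  \sum_(n <= m < N) (1 / 2 ^+ m) <= 2 / 2 ^+ n :> R.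
Proof.
have p k : 0 < 2 ^+ k :> R by rewrite exprn_gt0.
have [/subnKC <-|/ltnW Nn] := leqP n N; last first.
  by rewrite big_geq// divr_ge0// ltW.
suff -> : \sum_(n <= m < n + (N - n)) (1 / 2 ^+ m)
    = 2 / 2 ^+ n - 2 / 2 ^+ (n + (N - n)) :> R.
  by rewrite gerBl divr_ge0// ltW.
elim: (N - n)%N => [|k IH]; first by rewrite addn0 big_geq// subrr.
rewrite addnS big_nat_recr ?leq_addr//= IH exprS.
have := lt0r_neq0 (p (n + k)%N); have := lt0r_neq0 (p n).
move: (2 ^+ n) (2 ^+ (n + k)) => a b a0 b0.
by field; rewrite a0 b0.
Qed.

Section JumpFunction.
Variables (R : realType) (phi : nat -> rat).
Implicit Types (x y : R) (n N : nat).

Definition partial_F x N : R :=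
  \sum_(1 <= n < N | ratr (phi n) < x) (1 / 2 ^+ n).

Lemma half_pow_ge0 n : 0 <= 1 / 2 ^+ n :> R.
Proof. by rewrite divr_ge0// exprn_ge0. Qed.

Lemma partial_F_cvg x : partial_F x N @[N --> \oo] --> F phi x.
Proof.
suff : cvgn (partial_F x) by [].
apply: nondecreasing_is_cvgn.
  move=> M N MN; rewrite /partial_F.
  have [M1|M1] := leqP M 1.
    by rewrite big_geq// sumr_ge0// => i _; exact: half_pow_ge0.
  rewrite (@big_cat_nat _ _ _ M 1 N) ?(ltnW M1)//= lerDl sumr_ge0//.
  by move=> i _; exact: half_pow_ge0.
exists (2 / 2 ^+ 1) => _ [N _ <-].
apply: le_trans (sum_half_pow_le R 1 N).
rewrite /partial_F big_mkcond; apply: ler_sum => i _.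
by case: ifP => // _; exact: half_pow_ge0.
Qed.

(** Carries the estimates of finite sums below to the limit. *)
Lemma F_add_le x y a :
  (\forall N \near \oo, partial_F x N + a <= partial_F y N) ->
  F phi x + a <= F phi y.
Proof.
move=> H; apply: ler_cvg_to H; last exact: partial_F_cvg.
by apply: cvgD; [exact: partial_F_cvg|exact: cvg_cst].
Qed.

Lemma F_nondecreasing x y : x <= y -> F phi x <= F phi y.
Proof.
move=> xy; rewrite -[leLHS]addr0; apply: F_add_le; near=> N.
rewrite addr0 /partial_F big_mkcond [leRHS]big_mkcond; apply: ler_sum => i _.
case: ltP => [ix|_]; first by rewrite (lt_le_trans ix xy).
by case: ifP => // _; exact: half_pow_ge0.
Unshelve. all: by end_near. Qed.

Lemma F_jump x y n : (1 <= n)%N -> x <= ratr (phi n) < y ->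
  F phi x + 1 / 2 ^+ n <= F phi y.
Proof.
move=> n1 /andP[xn ny]; apply: F_add_le; near=> N.
have nN : (n < N)%N by near: N; exact: nbhs_infty_gt.
have nI : n \in index_iota 1 N by rewrite mem_index_iota n1.
rewrite /partial_F big_mkcond [leRHS]big_mkcond.
rewrite [leRHS](bigD1_seq n) ?iota_uniq//= ny [leRHS]addrC lerD2r.
rewrite [leRHS]big_mkcond; apply: ler_sum => i _ /=.
case: ltP => [ix|_].
  rewrite (lt_trans (lt_le_trans ix xn) ny) /=.
  by case: eqP ix => // ->; rewrite ltNge xn.
by do 2!case: ifP => // _; exact: half_pow_ge0.
Unshelve. all: by end_near. Qed.

(** Every point of the interval has index at least [n], and the masses of index
    at least [n] sum to twice the mass of index [n]. *)
Lemma F_increment_le x y n : (1 <= n)%N ->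
  (forall m, (1 <= m)%N -> x <= ratr (phi m) < y -> (n <= m)%N) ->
  F phi y <= F phi x + 2 / 2 ^+ n.
Proof.
move=> n1 nmin; rewrite -lerBlDr; apply: F_add_le; near=> N.
rewrite lerBlDr; apply: le_trans (lerD (lexx _) (sum_half_pow_le R n N)).
rewrite (big_nat_widenl n 1)//= /partial_F big_mkcond.
rewrite [X in _ <= X + _]big_mkcond [X in _ <= _ + X]big_mkcond -big_split /=.
rewrite big_nat_cond [leRHS]big_nat_cond; apply: ler_sum => i.
rewrite andbT => /andP[i1 _].
have p := half_pow_ge0 i.
case: ltP => [iy|_]; last by rewrite addr_ge0//; case: ifP.
case: ltP => [_|xi]; first by rewrite lerDl; case: ifP.
by rewrite nmin ?xi// add0r.
Unshelve. all: by end_near. Qed.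

End JumpFunction.

(** * The derivative *)

(** The right half of the definition of the derivative, with the quotient
    cleared so that the point [t = 0] is included. *)
Lemma derivable_linear_approx (R : realType) (f : R -> R) (x e : R) :
  derivable f x 1 -> 0 < e ->
  exists2 d : R, 0 < d & forall t, 0 <= t -> t < d ->
    `|f (x + t) - f x - derive1 f x * t| <= e * t.
Proof.
move=> df e0; have : h^-1 *: (f (h *: 1 + x) - f x) @[h --> 0^'] --> derive1 f x.
  by rewrite derive1E; exact: df.
move=> /cvgrPdist_le/(_ _ e0); rewrite near_withinE => -[d /= d0 H].
exists d => // t; rewrite le_eqVlt => /predU1P[<- _|t0 td].
  by rewrite addr0 subrr !mulr0 subrr normr0.
have := H t; rewrite /= sub0r normrN gtr0_norm// => /(_ td).
rewrite gt_eqF// => /(_ isT).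
rewrite [t *: 1]mulr1 [t + x]addrC => K.
rewrite -(ler_pM2r t0) in K.
suff -> : f (x + t) - f x - derive1 f x * t
    = - ((derive1 f x - t^-1 *: (f (x + t) - f x)) * t).
  by rewrite normrN normrM (gtr0_norm t0).
by rewrite /GRing.scale /=; field; exact: lt0r_neq0.
Qed.

Theorem mainTheorem3 (R : realType) (phi : nat -> rat)
    (phi_bij : set_bij [set n : nat | (1 <= n)%N] [set: rat] phi) :
  ~ exists xi : R, derivable (F phi) xi 1 /\ derive1 (F phi) xi <> 0.
Proof.
case=> xi [dF /eqP]; set c := derive1 _ _ => c0.
have e0 : 0 < `|c| / 6 by rewrite divr_gt0// normr_gt0.
have [d d0 approx] := derivable_linear_approx _ _ _ _ dF e0.
pose h := d / 2.
have h0 : 0 < h by rewrite divr_gt0.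
have hd : h < d by rewrite /h; lra.
have approx_le t : 0 <= t -> t <= h ->
    (c - `|c| / 6) * t <= F phi (xi + t) - F phi xi <= (c + `|c| / 6) * t.
  move=> t0 th; have := approx t t0 (le_lt_trans th hd).
  by rewrite ler_norml -/c => /andP[? ?]; apply/andP; split; lra.
have {c0} cpos : 0 < c.
  rewrite ltNge le_eqVlt (negbTE c0) /=; apply/negP => cneg.
  have /andP[_] := approx_le h (ltW h0) (lexx _).
  have : F phi xi <= F phi (xi + h) by apply: F_nondecreasing; rewrite lerDl ltW.
  by rewrite ltr0_norm//; nra.
rewrite gtr0_norm// {e0 approx} in approx_le.
pose P n := (1 <= n)%N && (xi <= ratr (phi n) < xi + h).
have exP : exists n, P n.
  (* density of the rationals and surjectivity of [phi] *)
  have [|q] := @rat_in_itvoo R xi (xi + h); first by rewrite ltrDl.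
  rewrite in_itv /= => /andP[xq qh].
  have [_ _ /(_ q I)[n /= n1 nq]] := phi_bij.
  by exists n; rewrite /P n1 nq (ltW xq) qh.
have [n /andP[n1 /andP[xn nh]] nmin] := ex_minnP exP.
have increment : F phi (xi + h) <= F phi xi + 2 / 2 ^+ n.
  by apply: F_increment_le => // m m1 xm; apply: nmin; rewrite /P m1.
pose r := ratr (phi n) - xi.
have r0 : 0 <= r by rewrite subr_ge0.
have rh : r < h by rewrite /r; lra.
(* [F phi (xi + t) - F phi xi] is at most [(c + c / 6) * t] for [t > r], at
   least [(c - c / 6) * r] at [t = r], and the difference of the two contains
   the jump; as [t] decreases to [r] this leaves [2 * (c / 6) * r]. *)
have jump : 1 / 2 ^+ n <= c / 3 * r.
  rewrite leNgt; apply/negP => big.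
  (* If the jump is larger, a step [s] past [r] is contradictory as soon as
     [7 / 6 * c * s] is less than the excess; take half of it. *)
  pose s := (1 / 2 ^+ n - c / 3 * r) / (2 * (7 / 6 * c)).
  have s0 : 0 < s by apply: divr_gt0; [rewrite subr_gt0|lra].
  have sE : 7 / 6 * c * s = (1 / 2 ^+ n - c / 3 * r) / 2.
    by rewrite /s; move: (1 / 2 ^+ n - _) => u; field; rewrite gt_eqF.
  pose t := Num.min h (r + s).
  have rt : r < t by rewrite lt_min rh ltrDl.
  have th : t <= h by rewrite ge_min lexx.
  have ts : t <= r + s by rewrite ge_min lexx orbT.
  have /andP[_ up] := approx_le t (ltW (le_lt_trans r0 rt)) th.
  have /andP[lo _] := approx_le r r0 (ltW rh).
  have : F phi (xi + r) + 1 / 2 ^+ n <= F phi (xi + t).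
    by apply: F_jump => //; rewrite /r subrKC lexx /= -ltrBlDl.
  clearbody t s r; nra.
have /andP[lo _] := approx_le h (ltW h0) (lexx _).
have E : 2 / 2 ^+ n = 2 * (1 / 2 ^+ n) :> R by rewrite mul1r.
rewrite E in increment.
nra.
Qed.
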